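(* Let $D$ be a digraph belonging to $\mathscr{D}(3,3)$ or to $\mathscr{D}(4,4)$. Then the edges of $D$ can be covered by at most five directed cuts; that is, there are at most five directed cuts of $D$ whose union is $E(D)$.
   Context: Digraphs are finite directed graphs without loops and without parallel edges (two edges $uv$ and $vu$ in opposite directions between the same pair of vertices are allowed). $V(D)$ and $E(D)$ denote the vertex set and edge set of $D$; $uv$ denotes an edge directed from $u$ to $v$. For nonnegative integers $k$ and $l$, $\mathscr{D}(k,l)$ denotes the family of digraphs in which every vertex has either indegree at most $k$ or outdegree at most $l$. For a bipartition $(X,Y)$ of $V(D)$ (a partition of $V(D)$ into two disjoint, possibly empty, sets $X$ and $Y$), the directed cut induced by $(X,Y)$ is the edge set $E(X,Y)=\{xy\in E(D) : x\in X,\ y\in Y\}$. A family of directed cuts of $D$ covers the edges of $D$ if every edge of $D$ lies in at least one of the cuts. *)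

(* Defs.v *)
(* A digraph is an irreflexive relation [e] on a finite type [V]:
   [e u v] says that uv is an edge, so parallel edges cannot occur, while
   [e u v] and [e v u] may both hold. *)
From mathcomp Require Import all_boot.

Set Implicit Arguments.
Unset Strict Implicit.
Unset Printing Implicit Defensive.

Section Digraph.

Variables (V : finType) (e : rel V).

Definition edges : {set V * V} := [set p | e p.1 p.2].

Definition indeg (v : V) : nat := #|[set u | e u v]|.

Definition outdeg (v : V) : nat := #|[set u | e v u]|.

Definition in_family (k l : nat) : Prop :=
  forall v : V, indeg v <= k \/ outdeg v <= l.

(* Unlike finset's [partition], this allows empty parts. *)
Definition bipartition (X Y : {set V}) : Prop :=
  X :|: Y = [set: V] /\ [disjoint X & Y].

Definition cut_edges (X Y : {set V}) : {set V * V} :=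
  [set p in edges | (p.1 \in X) && (p.2 \in Y)].

Definition directed_cut (C : {set V * V}) : Prop :=
  exists X Y : {set V}, bipartition X Y /\ C = cut_edges X Y.

End Digraph.

(* Main.v *)
Require Import Defs.
From mathcomp Require Import all_boot.
From mathcomp Require Import zify.

Set Implicit Arguments.
Unset Strict Implicit.
Unset Printing Implicit Defensive.

(** A covering by n directed cuts is the same thing as a labelling of the
vertices by subsets of an n-set in which the label of the tail of an edge is
never contained in the label of its head: the k-th cut leaves the set of
vertices whose label contains k.

Since D(3,3) is contained in D(4,4), only the latter matters.  Let X be the
set of vertices of indegree at most 4; all other vertices have outdegree at
most 4.  The colours are the ten 2-subsets of {0,...,4}.  A vertex outside X is
labelled by its colour, a vertex of X by the complement of its colour.  Then
an edge from X to the outside is always separated, an edge inside X or outside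
X is separated as soon as its ends have distinct colours, and an edge uv
entering X is separated if and only if the colours of u and v meet ([codeP]).

Once a set U of vertices outside X is coloured, a vertex v of X with b
in-neighbours in U has a list of admissible colours, those that meet the b
colours seen.  By inspection the list has at least 2(4-b) elements, while v has
at most 4-b in-neighbours in X ([num_meeting_ge]).  So X is only just not
guaranteed to be list-colourable: comparing the sum of the degrees with twice
the sum of the indegrees, every minimal uncolourable subset of X has all these
inequalities tight ([critical_tight]).  It is then closed under in-neighbours in
X and Eulerian, so that two such sets with a common vertex coincide
([critical_balanced_eq]).

The colouring outside X is built one vertex at a time, keeping X
list-colourable ([colouring_exists]).  Let u be the vertex to be coloured last
in U and let b be the number of its out-neighbours in X.  By averaging, u can be
chosen with at most 2(4-b) neighbours in U ([exists_small_nbrs]).  A colour of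
u that makes X uncolourable creates a critical set S through an out-neighbour
of u.  If v is the only out-neighbour of u in S, a colouring of S - v forces the
list of v to be exactly the set of colours of its neighbours in S, and the tight
lists obtained from different colours of u are different ([tight_inj]); so v is
responsible for one bad colour only ([fibre_unique]).  In any case v is
responsible for at most 4 bad colours ([count_tight]), a cost shared by at least
two out-neighbours when v is not alone in S.  Thus at most 2b colours are bad
([card_bad]), and 2(4-b) + 2b = 8 < 10 leaves a good colour for u. *)

(** * The ten colours *)

Definition pairs : seq (seq nat) :=
  [:: [:: 0; 1]; [:: 0; 2]; [:: 0; 3]; [:: 0; 4]; [:: 1; 2];
      [:: 1; 3]; [:: 1; 4]; [:: 2; 3]; [:: 2; 4]; [:: 3; 4]].

Definition in_pair (a k : nat) : bool := k \in nth [::] pairs a.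

Definition meets (a b : nat) : bool := has (in_pair a) (nth [::] pairs b).

Definition meets_all (s : seq nat) (a : nat) : bool := all (meets^~ a) s.

Definition num_meeting (s : seq nat) : nat :=
  count (meets_all s) (iota 0 10).

(** For a vertex that sees the colours [s], tightness means that the guaranteed
lower bound on the size of its list is attained. *)
Definition tight (s : seq nat) : bool :=
  num_meeting s == 2 * (4 - size s).

Fixpoint words (n : nat) : seq (seq nat) :=
  if n is n'.+1 then [seq c :: s | c <- iota 0 10, s <- words n'] else [:: [::]].

Lemma mem_words s : all (gtn 10) s -> s \in words (size s).
Proof.
elim: s => [// | c s IHs /andP[c10 s10]].
have -> : words (size (c :: s)) = [seq x :: t | x <- iota 0 10, t <- words (size s)] by [].
by apply: allpairs_f; rewrite ?mem_iota ?IHs.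
Qed.

Lemma all_words (P : pred (seq nat)) n :
    all (fun m => all P (words m)) (iota 0 n.+1) ->
  forall s, all (gtn 10) s -> size s <= n -> P s.
Proof.
move=> /allP Pn s s10 sn; have /Pn/allP : size s \in iota 0 n.+1 by rewrite mem_iota.
by apply; apply: mem_words.
Qed.

(** The bound is attained, up to the empty list: 01, 23 leave four colours,
01, 12, 34 leave two, and 01, 02, 12, 34 leave none. *)
Lemma num_meeting_ge s : all (gtn 10) s -> size s <= 4 ->
  2 * (4 - size s) <= num_meeting s.
Proof. by move: s; apply: all_words; vm_compute. Qed.

(** The extreme case is two disjoint colours in [s]: each of the four colours
through the fifth point then leaves a list of size two. *)
Lemma count_tight s : all (gtn 10) s -> size s <= 3 ->
  count (fun c => tight (c :: s)) (iota 0 10) <= 4.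
Proof. by move: s; apply: all_words; vm_compute. Qed.

(** When the colours [s] of the other in-neighbours are known, a tight list
determines the missing colour; this makes a prescribed list cost one colour. *)
Lemma tight_inj s c c' : all (gtn 10) s -> size s <= 3 ->
    c < 10 -> c' < 10 -> tight (c :: s) -> tight (c' :: s) ->
    {in iota 0 10, meets_all (c :: s) =1 meets_all (c' :: s)} ->
  c = c'.
Proof.
(* Nested conditionals rather than boolean connectives, since the virtual
   machine would evaluate both arguments of a connective. *)
pose P s := all (fun c => if tight (c :: s) then all (fun c' =>
    if tight (c' :: s) then
      all (fun a => meets_all (c :: s) a == meets_all (c' :: s) a) (iota 0 10)
      ==> (c == c') else true) (iota 0 10) else true) (iota 0 10).
move=> s10 s3 c10 c'10 tc tc' eq_tr.
have /allP/(_ c) : P s by move: s s10 s3 {tc tc' eq_tr}; apply: all_words; vm_compute.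
rewrite mem_iota tc => /(_ c10)/allP/(_ c'); rewrite mem_iota tc' => /(_ c'10).
move/implyP => imp; apply/eqP/imp.
by apply/allP => a /eq_tr ->.
Qed.

Lemma card_ord_count n (P : pred nat) : #|[set a : 'I_n | P a]| = count P (iota 0 n).
Proof. by rewrite cardsE cardE size_filter -val_enum_ord count_map enumT. Qed.

(** * Neighbourhoods *)

Section Digraph.

Variables (V : finType) (e : rel V).
Hypothesis e_irr : irreflexive e.

Definition ins (S : {set V}) v := [set w in S | e w v].
Definition outs (S : {set V}) v := [set w in S | e v w].
Definition nbrs (S : {set V}) v := [set w in S | e v w || e w v].

Lemma card_sep_disjoint (A B : {set V}) (p : pred V) : [disjoint A & B] ->
  #|[set w in A | p w]| + #|[set w in B | p w]| <= #|[set w in [set: V] | p w]|.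
Proof.
move=> disAB; rewrite -cardsUI (_ : _ :&: _ = set0); last first.
  apply/setP => w; rewrite !inE; have := disjointFr disAB (x := w).
  by case: (w \in A) => // /(_ isT)->; rewrite andbF.
rewrite cards0 addn0; apply/subset_leq_card/subsetP => w.
by rewrite !inE => /orP[] /andP[].
Qed.

Lemma card_nbrs S v : #|nbrs S v| <= #|ins S v| + #|outs S v|.
Proof.
apply: leq_trans (leq_card_setU _ _); apply/subset_leq_card/subsetP => w.
by rewrite !inE => /andP[-> /= /orP[] ->]; rewrite ?orbT.
Qed.

Lemma sum_ins_outs (A B : {set V}) :
  \sum_(v in A) #|ins B v| = \sum_(w in B) #|outs A w|.
Proof.
have card_sep (S : {set V}) (p : pred V) :
    #|[set w in S | p w]| = \sum_(w in S) if p w then 1 else 0.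
  by rewrite -big_mkcondr -sum1_card; apply: eq_bigl => w; rewrite inE.
under eq_bigr do rewrite card_sep; rewrite exchange_big /=.
by apply: eq_bigr => w _; rewrite card_sep.
Qed.

(** In the digraph induced by [U], the degrees sum to twice the outdegrees. *)
Lemma exists_small_nbrs (U : {set V}) : U != set0 ->
  exists2 u, u \in U & #|nbrs U u| <= 2 * #|outs U u|.
Proof.
move=> U0; apply/exists_inP; apply: contraT.
rewrite negb_exists_in => /forall_inP big.
have : \sum_(u in U) 2 * #|outs U u| < \sum_(u in U) #|nbrs U u|.
  have [u uU] := set0Pn _ U0.
  rewrite [X in X < _](bigD1 u) //= [X in _ < X](bigD1 u) //= -addSn leq_add //.
    by rewrite ltnNge big.
  by apply: leq_sum => w /andP[wU _]; rewrite ltnW // ltnNge big.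
rewrite ltnNge -big_distrr /= mul2n -addnn -{1}sum_ins_outs -big_split /=.
by rewrite leq_sum // => u _; apply: card_nbrs.
Qed.

(** * Minimal uncolourable sets *)

Section ListColouring.

Variable C : finType.
Implicit Types (L : V -> {set C}) (f : {ffun V -> C}) (S T : {set V}).

Definition colouring L S f : bool :=
  [forall v in S, (f v \in L v) && [forall w in S, e v w ==> (f v != f w)]].

Definition colourable L S : bool := [exists f, colouring L S f].

Lemma colouringP L S f :
  reflect ((forall v, v \in S -> f v \in L v) /\
           (forall v w, v \in S -> w \in S -> e v w -> f v != f w))
          (colouring L S f).
Proof.
apply: (iffP forall_inP) => [col | [fL fe] v vS].
  split=> v; first by move/col/andP => [].
  by move=> w /col/andP[_ /forall_inP fe] /fe/implyP.
by rewrite fL //; apply/forall_inP => w wS; apply/implyP; apply: fe.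
Qed.

Lemma eq_colouring L L' S f : {in S, L =1 L'} -> colouring L S f = colouring L' S f.
Proof. by move=> eqL; apply: eq_forallb_in => v vS; rewrite eqL. Qed.

Lemma eq_colourable L L' S : {in S, L =1 L'} -> colourable L S = colourable L' S.
Proof. by move=> eqL; apply: eq_existsb => f; apply: eq_colouring. Qed.

Lemma colourableS L S T : T \subset S -> colourable L S -> colourable L T.
Proof.
move=> /subsetP sTS /existsP[f /colouringP[fL fe]]; apply/existsP; exists f.
by apply/colouringP; split=> [v /sTS/fL //|v w /sTS vS /sTS wS]; apply: fe.
Qed.

Definition critical L S : bool := minset (fun T => ~~ colourable L T) S.

Lemma critical_proper L S T : critical L S -> T \proper S -> colourable L T.
Proof.
move=> /minsetP[_ minS] /andP[sTS nST]; apply: contraT => ncT.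
by rewrite (minS T ncT sTS) subxx in nST.
Qed.

Lemma exists_critical L X : ~~ colourable L X -> exists2 S, critical L S & S \subset X.
Proof.
move=> ncX; have [S minS sSX] := @minset_exists _ (fun T => ~~ colourable L T) X ncX.
by exists S.
Qed.

(** Otherwise a colour of [L v] unused on the neighbours of [v] would extend [f]
to [S]. *)
Lemma critical_list L S v f : critical L S -> v \in S ->
  colouring L (S :\ v) f -> L v \subset f @: nbrs S v.
Proof.
move=> crS vS /colouringP[fL fe]; apply/subsetP => a aL.
apply: contraT => a_new; move/minsetP: crS => [/negP[]].
apply/existsP; exists [ffun w => if w == v then a else f w]; apply/colouringP.
have new w : w \in S -> e v w || e w v -> a != f w.
  move=> wS vw; apply: contraNneq a_new => ->.
  by rewrite imset_f // inE wS.
split=> [w wS | x y xS yS]; rewrite !ffunE.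
  by case: (eqVneq w v) => [-> // | wv]; rewrite fL // !inE wv.
case: (eqVneq x v) => [-> | xv]; case: (eqVneq y v) => [-> | yv].
- by rewrite e_irr.
- by move=> vy; rewrite new ?vy.
- by move=> xv'; rewrite eq_sym new ?xv' ?orbT.
- by apply: fe; rewrite !inE ?xv ?yv.
Qed.

Lemma critical_card L S v : critical L S -> v \in S -> #|L v| <= #|nbrs S v|.
Proof.
move=> crS vS; have /existsP[f colf] := critical_proper crS (properD1 vS).
exact: leq_trans (subset_leq_card (critical_list crS vS colf)) (leq_imset_card _ _).
Qed.

(** Colourings of two proper parts without edges between them can be glued. *)
Lemma critical_connected L S T : critical L S -> T \subset S -> T != set0 ->
  (forall x y, x \in T -> y \in S :\: T -> ~~ e x y && ~~ e y x) -> T = S.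
Proof.
move=> crS sTS T0 sep; apply/eqP; rewrite eqEproper sTS /=.
apply/negP => pTS.
have /existsP[f /colouringP[fL fe]] := critical_proper crS pTS.
have /existsP[g /colouringP[gL ge]] : colourable L (S :\: T).
  apply: critical_proper crS _; rewrite properE subsetDl /=.
  have [x xT] := set0Pn _ T0; apply/subsetPn; exists x; first exact: subsetP sTS _ _.
  by rewrite inE xT.
move/minsetP: crS => [/negP[]]; apply/existsP.
exists [ffun w => if w \in T then f w else g w]; apply/colouringP.
split=> [w wS | x y xS yS]; rewrite !ffunE.
  by case: ifP => wT; [apply: fL | apply: gL; rewrite inE wT].
case: ifP => xT; case: ifP => yT exy.
- exact: fe.
- by have := sep x y xT; rewrite inE yT yS exy => /(_ isT).
- by have := sep y x yT; rewrite inE xT xS exy andbF => /(_ isT).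
- by apply: ge; rewrite // inE ?xT ?yT.
Qed.

(** In the subgraph induced by [X], no edge enters [S] from outside, and [S]
induces an Eulerian digraph. *)
Definition balanced (X S : {set V}) : Prop :=
  [/\ S \subset X, forall v, v \in S -> ins X v \subset S
    & forall v, v \in S -> #|outs S v| = #|ins S v|].

(** On a critical set each degree is at least the size of the list, hence at least
[2 * d v], while each indegree is at most [d v]. So each outdegree is at least
[d v], and as indegrees and outdegrees have the same sum, equality holds
throughout. *)
Lemma critical_tight L (X S : {set V}) (d : V -> nat) :
    (forall v, v \in X -> #|ins X v| <= d v) ->
    (forall v, v \in X -> 2 * d v <= #|L v|) ->
    S \subset X -> critical L S ->
  balanced X S /\ (forall v, v \in S -> #|L v| = 2 * d v /\ #|nbrs S v| = 2 * d v).
Proof.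
move=> insX dL sSX crS.
have sX v : v \in S -> v \in X by apply: subsetP.
have insSX v : ins S v \subset ins X v.
  by apply/subsetP => w; rewrite !inE => /andP[/sX-> ->].
have le_in v : v \in S -> #|ins S v| <= d v.
  by move=> /sX/insX; apply: leq_trans; apply: subset_leq_card.
have le_out v : v \in S -> d v <= #|outs S v|.
  move=> vS; have := le_in v vS; have := card_nbrs S v.
  by have := critical_card crS vS; have := dL v (sX v vS); lia.
have eq_sum : \sum_(v in S) #|ins S v| = \sum_(v in S) #|outs S v| := sum_ins_outs S S.
have eq_io v : v \in S -> #|ins S v| = #|outs S v|.
  have le_io w : w \in S -> #|ins S w| <= #|outs S w| ?= iff (#|ins S w| == #|outs S w|).
    by move=> wS; split=> //; apply: leq_trans (le_in w wS) (le_out w wS).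
  have [_] := leqif_sum le_io; rewrite eq_sum eqxx => /esym/forall_inP eq_io.
  by move/eq_io/eqP.
split; last first.
  move=> v vS; have := le_in v vS; have := le_out v vS; have := card_nbrs S v.
  by have := critical_card crS vS; have := dL v (sX v vS); have := eq_io v vS; lia.
split=> // [v vS|v /eq_io //].
suff <- : ins S v = ins X v by apply/subsetP => w; rewrite inE => /andP[].
apply/eqP; rewrite eqEcard insSX /=; have := insX v (sX v vS).
by have := le_out v vS; have := eq_io v vS; lia.
Qed.

(** No edge enters the intersection of [S] and [S'] from the rest of [S]; since [S]
is Eulerian, no edge leaves it either, and a critical set is connected. *)
Lemma critical_balanced_eq L (X S S' : {set V}) v : critical L S -> balanced X S ->
  balanced X S' -> v \in S -> v \in S' -> S \subset S'.
Proof.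
move=> crS [sSX inS eqS] [sSX' inS' _] vS vS'; apply/setIidPl.
apply: (critical_connected crS (subsetIl _ _)).
  by apply/set0Pn; exists v; rewrite inE vS.
have no_in x y : x \in S :&: S' -> y \in S :\: (S :&: S') -> ~~ e y x.
  rewrite !inE => /andP[xS xS'] /andP[yn yS]; apply: contraNN yn => yx.
  by rewrite yS (subsetP (inS' _ xS')) // inE (subsetP sSX).
have sub_out w : outs (S :&: S') w \subset outs S w.
  by apply/subsetP => z; rewrite !inE => /andP[/andP[-> _] ->].
have eq_out w : w \in S :&: S' -> outs (S :&: S') w = outs S w.
  have le_out z : z \in S :&: S' ->
      #|outs (S :&: S') z| <= #|outs S z| ?= iff (outs (S :&: S') z == outs S z).
    by move=> _; apply: subset_leqif_cards.
  have [_] := leqif_sum le_out.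
  rewrite -sum_ins_outs => /esym eq_all wI; apply/eqP; move: w wI; apply/forall_inP.
  rewrite eq_all; apply/eqP/eq_bigr => z zI.
  rewrite eqS; last by case/setIP: zI.
  apply: eq_card => y; rewrite !inE; case yz: (e y z); rewrite ?andbF // !andbT.
  case yS: (y \in S) => //=; apply: contraTT yz => yS'.
  by apply: no_in zI _; rewrite !inE yS yS'.
move=> x y xI yD; rewrite (no_in x y) // andbT; apply/negP => xy.
have : y \in outs S x by rewrite inE xy andbT; case/setDP: yD.
by rewrite -eq_out // inE => /andP[yI _]; case/setDP: yD; rewrite yI.
Qed.

End ListColouring.

(** * Extending the colouring by one vertex *)

Definition lists (U : {set V}) (col : V -> 'I_10) (v : V) : {set 'I_10} :=
  [set a : 'I_10 | [forall u in ins U v, meets (col u) a]].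

Lemma lists_meets_all (U : {set V}) col v s :
    (forall c, (c \in s) = (c \in [seq nat_of_ord (col u) | u <- enum (ins U v)])) ->
  lists U col v = [set a : 'I_10 | meets_all s a].
Proof.
move=> eqs; apply/setP => a; rewrite !inE; apply/forall_inP/allP => [ma c | ma u uU].
  by rewrite eqs => /mapP[u]; rewrite mem_enum => uU ->; apply: ma.
by apply: ma; rewrite eqs; apply/mapP; exists u; rewrite ?mem_enum.
Qed.

Lemma card_lists (U : {set V}) col v s :
    (forall c, (c \in s) = (c \in [seq nat_of_ord (col u) | u <- enum (ins U v)])) ->
  #|lists U col v| = num_meeting s.
Proof. by move=> /lists_meets_all->; rewrite card_ord_count. Qed.

(** Here [u] is a vertex of [U] still without colour, and [col] is a colouring of
the rest of [U] that leaves [X] list-colourable. *)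
Section Extension.

Variables (X U : {set V}) (u : V) (col : V -> 'I_10).
Hypothesis disXU : [disjoint X & U].
Hypothesis indegX : forall v, v \in X -> #|ins [set: V] v| <= 4.
Hypothesis uU : u \in U.
Hypothesis colX : colourable (lists (U :\ u) col) X.

Definition recol (c : 'I_10) (w : V) : 'I_10 := if w == u then c else col w.

Definition bad : {set 'I_10} := [set c | ~~ colourable (lists U (recol c)) X].

(** A critical subset of [X] that explains why the colour [c] of [u] is bad. *)
Definition obstruction (c : 'I_10) : {set V} :=
  odflt set0 [pick S : {set V} | critical (lists U (recol c)) S & S \subset X].

Lemma obstructionP c : c \in bad ->
  critical (lists U (recol c)) (obstruction c) /\ obstruction c \subset X.
Proof.
rewrite inE => /exists_critical[S crS sSX]; rewrite /obstruction.
by case: pickP => [T /andP[] | /(_ S)] //; rewrite crS sSX.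
Qed.

Lemma ins_bound v : v \in X -> #|ins X v| + #|ins U v| <= 4.
Proof.
move=> vX; apply: leq_trans (indegX vX).
exact: card_sep_disjoint.
Qed.

Lemma lists_ge col' v : v \in X -> 2 * (4 - #|ins U v|) <= #|lists U col' v|.
Proof.
move=> vX; rewrite (card_lists (fun=> erefl)).
set s := map _ _; have <- : size s = #|ins U v| by rewrite size_map -cardE.
apply: num_meeting_ge; first by apply/allP => _ /mapP[w _ ->] /=.
by rewrite size_map -cardE; have := ins_bound vX; lia.
Qed.

Lemma obstruction_tight c : c \in bad ->
  balanced X (obstruction c) /\
  (forall v, v \in obstruction c ->
     #|lists U (recol c) v| = 2 * (4 - #|ins U v|) /\
     #|nbrs (obstruction c) v| = 2 * (4 - #|ins U v|)).
Proof.
move=> /obstructionP[cr sub]; apply: critical_tight sub cr => [v vX | v].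
  by have := ins_bound vX; lia.
exact: lists_ge.
Qed.

Lemma obstruction_eq c c' v : c \in bad -> c' \in bad ->
  v \in obstruction c -> v \in obstruction c' -> obstruction c = obstruction c'.
Proof.
move=> cB cB' vc vc'; apply/eqP; rewrite eqEsubset.
have [[cr _] [cr' _]] := (obstructionP cB, obstructionP cB').
have [[bal _] [bal' _]] := (obstruction_tight cB, obstruction_tight cB').
apply/andP; split; first exact: critical_balanced_eq cr bal bal' vc vc'.
exact: critical_balanced_eq cr' bal' bal vc' vc.
Qed.

Lemma lists_recol_nonout c v : ~~ e u v -> lists U (recol c) v = lists (U :\ u) col v.
Proof.
move=> nuv; apply/setP => a; rewrite !inE; apply: eq_forallb => w.
rewrite !inE /recol; case: (eqVneq w u) => [-> | _] //.
by rewrite (negPf nuv) andbF.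
Qed.

(** Away from the out-neighbours of [u] the lists are those given by [col], for
which [X] is colourable. *)
Lemma obstruction_meets c : c \in bad -> exists2 v, v \in outs X u & v \in obstruction c.
Proof.
move=> cB; have [cr sub] := obstructionP cB.
apply/exists_inP; apply: contraT; rewrite negb_exists_in => /forall_inP none.
move/minsetP: cr => [/negP[]].
rewrite (@eq_colourable _ _ (lists (U :\ u) col)); first exact: colourableS sub colX.
move=> v vS; apply: lists_recol_nonout; apply: contraL (vS) => uv; apply: none.
by rewrite inE uv (subsetP sub).
Qed.

Definition others v : seq nat := [seq nat_of_ord (col w) | w <- enum (ins (U :\ u) v)].

Lemma others_lt v : all (gtn 10) (others v).
Proof. by apply/allP => _ /mapP[w _ ->] /=. Qed.

Lemma mem_others c v : e u v -> forall a, (a \in nat_of_ord c :: others v) =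
  (a \in [seq nat_of_ord (recol c w) | w <- enum (ins U v)]).
Proof.
move=> uv a; rewrite inE; apply/predU1P/mapP => [[-> | /mapP[w]] | [w]].
- by exists u; rewrite ?mem_enum ?inE ?uU ?uv // /recol eqxx.
- rewrite mem_enum !inE => /andP[/andP[wu wU] wv] ->.
  by exists w; rewrite ?mem_enum ?inE ?wU ?wv // /recol (negPf wu).
rewrite mem_enum inE => /andP[wU wv] ->; rewrite /recol.
case: (eqVneq w u) => [_ | wu]; [by left | right].
by apply/mapP; exists w; rewrite ?mem_enum ?inE ?wu ?wU.
Qed.

Lemma size_others v : e u v -> #|ins U v| = (size (others v)).+1.
Proof.
move=> uv; rewrite size_map -cardE (cardsD1 u) inE uU uv add1n; congr _.+1.
by apply: eq_card => w; rewrite !inE andbA.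
Qed.

Lemma size_others3 v : v \in outs X u -> size (others v) <= 3.
Proof. by rewrite inE => /andP[vX uv]; have := ins_bound vX; rewrite size_others //; lia. Qed.

Lemma bad_tight c v : c \in bad -> v \in outs X u -> v \in obstruction c ->
  tight (nat_of_ord c :: others v).
Proof.
move=> cB; rewrite inE => /andP[vX uv] vc.
have [_ /(_ v vc)[cardL _]] := obstruction_tight cB.
by rewrite /tight -(card_lists (mem_others c uv)) cardL size_others.
Qed.

(** The bad colours for which the out-neighbour [v] of [u] is responsible. *)
Definition fibre v : {set 'I_10} := [set c in bad | v \in obstruction c].

Lemma card_fibre v : v \in outs X u -> #|fibre v| <= 4.
Proof.
move=> uv; apply: leq_trans (count_tight (others_lt v) (size_others3 uv)).
rewrite -card_ord_count; apply/subset_leq_card/subsetP => c; rewrite !inE => /andP[cB vc].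
by apply: bad_tight vc => //; rewrite inE.
Qed.

(** Both colours have the same obstruction [S], and outside [v] the lists on [S] do
not depend on the colour of [u]. A colouring of [S] without [v] thus serves both,
and by tightness it forces both lists of [v] to be the set of colours it uses on
the neighbours of [v]. *)
Lemma fibre_unique v c c' : v \in outs X u -> c \in fibre v -> c' \in fibre v ->
  outs X u :&: obstruction c = [set v] -> c' = c.
Proof.
move=> uv; rewrite ![_ \in fibre v]inE => /andP[cB vc] /andP[cB' vc'] only_v.
have eqS := obstruction_eq cB cB' vc vc'.
have [cr sub] := obstructionP cB; have [cr' _] := obstructionP cB'.
have [_ /(_ v vc)[cardL cardN]] := obstruction_tight cB.
have [_ /(_ v vc')[cardL' _]] := obstruction_tight cB'.
rewrite -eqS in cr'; have /existsP[f colf] := critical_proper cr (properD1 vc).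
have colf' : colouring (lists U (recol c')) (obstruction c :\ v) f.
  suff eqL : {in obstruction c :\ v, lists U (recol c) =1 lists U (recol c')}.
    by have <- := eq_colouring f eqL.
  move=> w /setD1P[wv wS]; have nuw : ~~ e u w.
    apply: contraNN wv => uw.
    by rewrite -in_set1 -only_v !inE uw wS (subsetP sub).
  by rewrite (lists_recol_nonout c nuw) (lists_recol_nonout c' nuw).
have lists_image col' : #|lists U col' v| = 2 * (4 - #|ins U v|) ->
    lists U col' v \subset f @: nbrs (obstruction c) v ->
    lists U col' v = f @: nbrs (obstruction c) v.
  by move=> card' sub'; apply/eqP; rewrite eqEcard sub' card' -cardN leq_imset_card.
have := lists_image _ cardL' (critical_list cr' vc colf').
rewrite -(lists_image _ cardL (critical_list cr vc colf)).
have euv : e u v by move: uv; rewrite inE => /andP[].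
rewrite !(lists_meets_all (mem_others _ euv)) => /setP eqL.
apply/val_inj/(tight_inj (others_lt v) (size_others3 uv) (ltn_ord c') (ltn_ord c)
  (bad_tight cB' uv vc') (bad_tight cB uv vc)).
move=> a; rewrite mem_iota => a10.
by have := eqL (Ordinal a10); rewrite !inE.
Qed.

(** Each bad colour [c] distributes a weight of at least 2 over the out-neighbours
of [u] in its obstruction: weight 2 if there is only one, weight 1 each
otherwise. By the two previous lemmas no out-neighbour receives more than 4. *)
Lemma card_bad : #|bad| <= 2 * #|outs X u|.
Proof.
pose k c := #|outs X u :&: obstruction c|.
pose wt c := if k c == 1 then 2 else 1.
suff : 2 * #|bad| <= 4 * #|outs X u| by lia.
have wt_ge c : c \in bad -> 2 <= \sum_(v in outs X u | v \in obstruction c) wt c.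
  move=> cB; rewrite sum_nat_const.
  have -> : #|[pred v | (v \in outs X u) && (v \in obstruction c)]| = k c.
    by apply: eq_card => v; rewrite [RHS]inE.
  have : 0 < k c.
    have [v vN vc] := obstruction_meets cB.
    by apply/card_gt0P; exists v; rewrite inE vN.
  by rewrite /wt; case: eqP => [-> // | ]; lia.
rewrite mulnC -sum_nat_const.
apply: (@leq_trans (\sum_(c in bad) \sum_(v in outs X u | v \in obstruction c) wt c)).
  exact: leq_sum.
rewrite (exchange_big_dep (mem (outs X u))) /=; last by move=> c v _ /andP[].
rewrite mulnC -sum_nat_const; apply: leq_sum => v vN.
have -> : \sum_(c in bad | (v \in outs X u) && (v \in obstruction c)) wt c =
    \sum_(c in fibre v) wt c.
  by apply: eq_bigl => c; rewrite [in RHS]inE vN.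
have [/exists_inP[c cF /cards1P[w only_w]] | ] :=
  boolP [exists c in fibre v, k c == 1].
  have only_v : outs X u :&: obstruction c = [set v].
    have : v \in outs X u :&: obstruction c.
      by rewrite inE vN; move: cF; rewrite inE => /andP[].
    by rewrite only_w inE => /eqP->.
  have -> : fibre v = [set c].
    apply/setP => c'; rewrite inE; apply/idP/eqP => [c'F | -> //].
    exact: fibre_unique c'F only_v.
  by rewrite big_set1 /wt; case: ifP.
rewrite negb_exists_in => /forall_inP no1.
rewrite (eq_bigr (fun=> 1)); first by rewrite sum1_card card_fibre.
by move=> c /no1; rewrite /wt => /negPf->.
Qed.

End Extension.

(** Induction on [U]. For the empty set every list has 10 elements, which is more
than the 8 of a tight list. *)
Lemma colouring_exists (X U : {set V}) : [disjoint X & U] ->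
    (forall v, v \in X -> #|ins [set: V] v| <= 4) ->
    (forall v, v \in U -> #|outs [set: V] v| <= 4) ->
  exists col : V -> 'I_10,
    (forall v w, v \in U -> w \in U -> e v w -> col v != col w) /\
    colourable (lists U col) X.
Proof.
move=> disXU indegX; have [n] := ubnP #|U|; elim: n U disXU => // n IHn U disXU leU outdegU.
have [-> | U0] := eqVneq U set0.
  exists (fun=> ord0); split=> [v w|]; first by rewrite inE.
  apply: contraT => /exists_critical[S crS sSX].
  have full v : lists set0 (fun=> ord0) v = setT.
    by apply/setP => a; rewrite !inE; apply/forall_inP => w; rewrite !inE.
  have [_ tightS] : balanced X S /\ (forall v, v \in S ->
      #|lists set0 (fun=> ord0) v| = 2 * 4 /\ #|nbrs S v| = 2 * 4).
    apply: critical_tight sSX crS => v vX; last by rewrite full cardsT card_ord.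
    apply: leq_trans (indegX v vX); apply/subset_leq_card/subsetP => w.
    by rewrite !inE => /andP[].
  have S0 : S = set0.
    apply/setP => v; rewrite inE; apply/negP => /tightS[].
    by rewrite full cardsT card_ord.
  move/minsetP: crS => [/negP[]]; apply/existsP; exists [ffun=> ord0].
  by apply/colouringP; rewrite S0; split=> [v | v w]; rewrite inE.
have [u uU small] := exists_small_nbrs U0.
have [col [colU colX]] : exists col : V -> 'I_10,
    (forall v w, v \in U :\ u -> w \in U :\ u -> e v w -> col v != col w) /\
    colourable (lists (U :\ u) col) X.
  apply: IHn.
  - by apply: disjointWr disXU; apply: subsetDl.
  - by move: leU; rewrite (cardsD1 u) uU.
  - by move=> v /setD1P[_ /outdegU].
have [c c_new] : exists c, c \notin bad X U u col :|: col @: nbrs U u.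
  have outs_le : #|outs X u| + #|outs U u| <= 4.
    apply: leq_trans (outdegU u uU).
    exact: card_sep_disjoint.
  have : #|bad X U u col :|: col @: nbrs U u| < #|'I_10|.
    rewrite card_ord; apply: leq_ltn_trans (leq_card_setU _ _) _.
    have le_bad := card_bad disXU indegX uU colX.
    have le_im : #|col @: nbrs U u| <= #|nbrs U u| := leq_imset_card _ _.
    apply: leq_ltn_trans (leq_add le_bad (leq_trans le_im small)) _.
    by rewrite -mulnDr; apply: (@leq_ltn_trans (2 * 4)); rewrite ?leq_mul2l ?outs_le.
  rewrite -cardsT ltnNge => small_avoid; apply/existsP.
  apply: contraR small_avoid; rewrite negb_exists => /forallP all_in.
  by apply/subset_leq_card/subsetP => c _; rewrite -[_ \in _]negbK.
move: c_new; rewrite !inE negb_or negbK => /andP[c_ok c_new].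
have c_nbr w : w \in U -> e u w || e w u -> c != col w.
  by move=> wU uw; apply: contraNneq c_new => ->; rewrite imset_f // inE wU.
exists (recol u col c); split=> // v w vU wU; rewrite /recol.
case: (eqVneq v u) => [-> | vu]; case: (eqVneq w u) => [-> | wu].
- by rewrite e_irr.
- by move=> uw; rewrite c_nbr ?uw.
- by move=> wu'; rewrite eq_sym c_nbr ?wu' ?orbT.
- by apply: colU; rewrite !inE ?vu ?wu.
Qed.

End Digraph.

(** * From labels to cuts *)

(** The label of a vertex coloured [a]; [top] tells whether the vertex has
indegree at most 4. *)
Definition code (top : bool) (a k : nat) : bool := top (+) in_pair a k.

Lemma codeP (s t : bool) (a b : nat) : a < 10 -> b < 10 ->
    (if s == t then a != b else s || meets a b) ->
  exists2 k, k < 5 & code s a k && ~~ code t b k.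
Proof.
pose P (s t : bool) a b := (if s == t then a != b else s || meets a b) ==>
  has (fun k => code s a k && ~~ code t b k) (iota 0 5).
have table : all (fun s => all (fun t =>
    all (fun a => all (P s t a) (iota 0 10)) (iota 0 10)) [:: true; false]) [:: true; false].
  by vm_compute.
move=> a10 b10 sep; have /hasP[k] : has (fun k => code s a k && ~~ code t b k) (iota 0 5).
  apply: implyP sep; move: table => /allP/(_ s)H.
  have /allP/(_ t)H1 := H ltac:(by case: (s)).
  have /allP/(_ a) := H1 ltac:(by case: (t)).
  by rewrite mem_iota => /(_ a10)/allP/(_ b); rewrite mem_iota => /(_ b10).
by rewrite mem_iota => k5 sep_k; exists k.
Qed.

Lemma cuts_of_labels (V : finType) (e : rel V) (n : nat) (label : V -> nat -> bool) :
    (forall u v, e u v -> exists2 k, k < n & label u k && ~~ label v k) ->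
  exists F : {set {set V * V}},
    [/\ #|F| <= n, forall C, C \in F -> directed_cut e C & cover F = edges e].
Proof.
move=> sep; pose X (k : 'I_n) := [set v | label v k].
exists [set cut_edges e (X k) (~: X k) | k : 'I_n]; split.
- by apply: leq_trans (leq_imset_card _ _) _; rewrite card_ord.
- move=> _ /imsetP[k _ ->]; exists (X k), (~: X k); split=> //.
  by split; [apply: setUCr | rewrite -setI_eq0 setICr].
apply/setP => -[u v]; apply/bigcupP/idP => [[_ /imsetP[k _ ->]] | ].
  by rewrite inE => /andP[].
rewrite inE => /= euv; have [k kn /andP[uk vk]] := sep u v euv.
exists (cut_edges e (X (Ordinal kn)) (~: X (Ordinal kn))); first exact: imset_f.
by rewrite !inE /= euv uk vk.
Qed.

Theorem theorem4 (V : finType) (e : rel V) (e_irr : irreflexive e)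
    (He : in_family e 3 3 \/ in_family e 4 4) :
  exists F : {set {set V * V}},
    [/\ #|F| <= 5, forall C, C \in F -> directed_cut e C & cover F = edges e].
Proof.
have {}He : in_family e 4 4.
  case: He => // He v; case: (He v) => deg3; [left | right]; exact: leq_trans deg3 _.
pose X := [set v | indeg e v <= 4].
have insE v : #|ins e [set: V] v| = indeg e v by apply: eq_card => w; rewrite !inE.
have outsE v : #|outs e [set: V] v| = outdeg e v by apply: eq_card => w; rewrite !inE.
have [] := @colouring_exists V e e_irr X (~: X).
- by rewrite -setI_eq0 setICr.
- by move=> v; rewrite insE inE.
- by move=> v; rewrite outsE !inE; case: (He v) => // ->.
move=> col [colU /existsP[f /colouringP[fL fX]]].
apply: (@cuts_of_labels _ _ _ (fun v => code (v \in X) (if v \in X then f v else col v))).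
move=> u v euv; apply: codeP; try by case: ifP.
have [uX | uX] := boolP (u \in X); have [vX | vX] := boolP (v \in X) => //=.
- exact: fX.
- have := fL v vX; rewrite inE => /forall_inP/(_ u); apply.
  by rewrite inE euv in_setC uX.
- by apply: colU euv; rewrite in_setC.
Qed.
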